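(* Let $n\in\mathbb{N}_0$, $m\in\{0,\ldots,2n\}$, let $A\subseteq\mathbb{R}^{2n}$ be a countably $m$-rectifiable subset and $B\subseteq\mathbb{R}^{2n}$ a $(2n-m)$-negligible subset. Then there exists a linear function $H:\mathbb{R}^{2n}\to\mathbb{R}$ such that for almost every $t\in\mathbb{R}$ (i.e., for all $t$ in a set of full one-dimensional Lebesgue measure) we have \[\varphi_H^t(A)\cap B=\emptyset,\] where $\varphi_H^t$ denotes the Hamiltonian time-$t$ flow of $H$ with respect to the standard symplectic form $\omega^{\mathrm{st}}$ on $\mathbb{R}^{2n}$.
   Context: $\mathbb{N}_0=\{0,1,2,\ldots\}$. $\mathbb{R}^{\ell}$ carries the Euclidean distance, and subsets carry the restricted distance. Let $(X,d)$ be a metric space and $s\in[0,\infty)$. $X$ is called $s$-negligible iff for every $\varepsilon\in(0,\infty)$ there exists a countable collection $\mathcal{S}$ of subsets of $X$ covering $X$ such that $\sum_{S\in\mathcal{S}}(\operatorname{diam}S)^s<\varepsilon$, with the convention $0^0:=1$. (Equivalently, the $s$-dimensional outer Hausdorff measure of $X$ vanishes.) For $m\in\mathbb{N}_0$, $X$ is called countably $m$-rectifiable iff there exists a countable (possibly empty or finite) set $\mathcal{F}$ of Lipschitz maps with domains given by subsets of $\mathbb{R}^m$ and target $X$, such that $X=\bigcup_{f\in\mathcal{F}}\operatorname{im}(f)$. The Hamiltonian vector field $X_H$ of $H$ is defined by $\iota_{X_H}\omega^{\mathrm{st}}=dH$, and $\varphi_H^t$ is its flow. For linear $H$ it is globally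 defined for all times. *)

(* Defs.v *)
From HB Require Import structures.
From mathcomp Require Import all_boot all_order all_algebra.
From mathcomp Require Import all_classical all_reals all_analysis.

Set Implicit Arguments.
Unset Strict Implicit.
Unset Printing Implicit Defensive.
Import Order.TTheory GRing.Theory Num.Theory.
Import numFieldNormedType.Exports.
Local Open Scope classical_set_scope.
Local Open Scope ring_scope.

(* The library norm on ['rV[R]_l] is the sup norm, hence the explicit
   Euclidean distance. *)
Definition eucl_dist (R : realType) (l : nat) (u v : 'rV[R]_l) : R :=
  Num.sqrt (\sum_i (u ord0 i - v ord0 i) ^+ 2).

(* In the metric notions below, a metric space is a subset [X] of a type with a
   distance function [d], and carries the restriction of [d]. *)

(* Adjoining 0 only matters for [S = set0], where it gives diameter 0
   (the supremum of the empty set in [\bar R] is -oo). *)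
Definition diam (R : realType) (T : Type) (d : T -> T -> R) (S : set T) : \bar R :=
  ereal_sup (0%E |` [set (d x y)%:E | x in S & y in S]).

(* [poweR] satisfies 0 `^ 0 = 1, so for [s = 0] every member of the collection,
   the empty set included, contributes at least 1. For this reason the
   collection is a countable set of sets and not a sequence. *)
Definition s_negligible (R : realType) (T : Type) (d : T -> T -> R) (s : R)
    (X : set T) : Prop :=
  forall e : R, 0 < e ->
    exists C : set (set T),
      [/\ countable C,
          (forall S, C S -> S `<=` X),
          X `<=` \bigcup_(S in C) S &
          (\esum_(S in C) poweR (diam d S) s < e%:E)%E].

Definition lipschitz_map (R : realType) (T U : Type) (dT : T -> T -> R)
    (dU : U -> U -> R) (D : set T) (f : T -> U) : Prop :=
  exists L : R, forall x y, D x -> D y -> dU (f x) (f y) <= L * dT x y.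

(* A map defined on a subset of R^m is a pair of its domain and a total function
   whose values outside the domain are irrelevant. That these maps have target
   [X] is part of the last equality. *)
Definition countably_rectifiable (R : realType) (T : Type) (d : T -> T -> R)
    (m : nat) (X : set T) : Prop :=
  exists F : set (set 'rV[R]_m * ('rV[R]_m -> T)),
    [/\ countable F,
        (forall g, F g -> lipschitz_map (@eucl_dist R m) d g.1 g.2) &
        X = \bigcup_(g in F) (g.2 @` g.1)].

(* R^2n is ['rV[R]_(n + n)] with coordinates (q_1, .., q_n, p_1, .., p_n), and
   the form is the sum of the dq_i /\ dp_i. *)
Definition omega_st (R : realType) (n : nat) (u v : 'rV[R]_(n + n)) : R :=
  \sum_(i < n) (u ord0 (lshift n i) * v ord0 (rshift n i)
                - u ord0 (rshift n i) * v ord0 (lshift n i)).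

Definition is_hamiltonian_vf (R : realType) (n : nat)
    (H : 'rV[R]_(n + n) -> R^o) (X : 'rV[R]_(n + n) -> 'rV[R]_(n + n)) : Prop :=
  forall x, differentiable H x /\ forall v, omega_st (X x) v = 'd H x v.

Definition is_flow (R : realType) (l : nat) (X : 'rV[R]_l -> 'rV[R]_l)
    (phi : R -> 'rV[R]_l -> 'rV[R]_l) : Prop :=
  (forall x, phi 0 x = x) /\
  (forall x (t : R), is_derive (t : R^o) (1 : R^o)
                       (fun s : R^o => phi s x) (X (phi t x))).

(* For linear [H] the Hamiltonian vector field exists and is constant, so
   there is exactly one such [phi]. *)
Definition is_hamiltonian_flow (R : realType) (n : nat)
    (H : 'rV[R]_(n + n) -> R^o)
    (phi : R -> 'rV[R]_(n + n) -> 'rV[R]_(n + n)) : Prop :=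
  exists X, is_hamiltonian_vf H X /\ is_flow X phi.

(* Main.v *)
(* The Hamiltonian vector field of a linear function is a constant vector v, so
   the flow is x |-> x + t v, and every v arises in this way. It remains to find
   v with t v outside B - A for almost every t.

   When m = 2n, B is empty. Otherwise cover B by sets S_i of diameter at most
   h_i such that every point of B lies in infinitely many S_i and the sum of
   h_i^(2n - m) is finite. If f is a Lipschitz piece of A and a cube is cut into
   about h_i^(-m) cells of side h_i, then the sets S_i - f(cell) have diameter
   O(h_i) and the sum of (diameter)^2n over all i and all cells is still finite.
   Write v = (w_1, .., w_(2n-1), 1) with w in the unit cube. For |t| >= 1/K the
   pairs (t, w) with t v in a given set S_i - f(cell) lie in a box of side
   O(h_i). Choosing w_1, w_2, .. and finally t one after the other, almost every
   choice keeps finite the sum of the remaining powers of the side lengths over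
   the boxes still hit (Borel-Cantelli in each coordinate). So for almost every
   t only finitely many boxes are hit, whereas a point of B in A + t v would give
   infinitely many. *)
Require Import Defs.
From HB Require Import structures.
From mathcomp Require Import all_boot all_order all_algebra.
From mathcomp Require Import all_classical all_reals all_analysis.
From mathcomp Require Import measurable_realfun ring lra.
Import Order.TTheory GRing.Theory Num.Theory.
Import numFieldNormedType.Exports.
Local Open Scope classical_set_scope.
Local Open Scope ring_scope.

(** * Borel-Cantelli, one coordinate at a time *)

(** By Tonelli, the integral over [w] of the series is at most the sum of the [a i g] times the
    interval lengths [2 * h i]. An integrable function is finite almost everywhere. The weights let
    the lemma be iterated over coordinates. *)
Lemma ae_weighted_hits_finite (R : realType) (N : nat -> nat)
    (a c : nat -> nat -> R) (h : nat -> R) :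
  (forall i g, 0 <= a i g) -> (forall i, 0 <= h i) ->
  (\sum_(0 <= i <oo) \sum_(g < N i) (a i g * h i)%:E < +oo)%E ->
  {ae (@lebesgue_measure R), forall w : R,
    (\sum_(0 <= i <oo) \sum_(g < N i)
       (a i g * (`|w - c i g| <= h i)%R%:R)%:E < +oo)%E}.
Proof.
move=> a0 h0 fin.
pose I i g : set R := [set` `[c i g - h i, c i g + h i]].
have mI i g : measurable (I i g) by exact: measurable_itv.
pose f i (w : R) := (\sum_(g < N i) (a i g)%:E * (\1_(I i g) w)%:E)%E.
have f_ge0 i w : (0 <= f i w)%E.
  by apply: sume_ge0 => g _; rewrite -EFinM lee_fin mulr_ge0.
have mg i g : measurable_fun setT (fun w : R => (a i g)%:E * (\1_(I i g) w)%:E : \bar R)%E.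
  apply: emeasurable_funM; first exact: measurable_cst.
  by apply/measurable_EFinP; exact: measurable_indic.
have mf i : measurable_fun setT (f i) by apply: emeasurable_sum.
have intf : (\int[@lebesgue_measure R]_w (\sum_(0 <= i <oo) f i w) < +oo)%E.
  rewrite integral_nneseries//.
  apply: (@le_lt_trans _ _ (\sum_(0 <= i <oo)
      (2%:E * \sum_(g < N i) (a i g * h i)%:E))%E); last first.
    rewrite nneseriesZl; last first.
      by move=> i _; apply: sume_ge0 => g _; rewrite lee_fin mulr_ge0.
    by rewrite lte_mul_pinfty.
  apply: lee_nneseries => [i _ _|i _]; first exact: integral_ge0.
  rewrite /f ge0_integral_sum//; last 2 first.
    by move=> g; exact: mg.
    by move=> g w _; rewrite -EFinM lee_fin mulr_ge0.
  rewrite ge0_sume_distrr; last by move=> g _; rewrite lee_fin mulr_ge0.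
  apply: lee_sum => g _.
  rewrite ge0_integralZl; last 4 first.
    exact: measurableT.
    by apply/measurable_EFinP; apply: measurable_indic; exact: mI.
    by move=> w _; rewrite lee_fin.
    by rewrite lee_fin.
  rewrite integral_indic ?setIT; [|exact: measurableT|exact: mI].
  have E2 : (2 * (a i g * h i)%:E = (a i g)%:E * (2 * h i)%R%:E :> \bar R)%E.
    by rewrite -!EFinM; congr (_%:E); ring.
  rewrite E2; apply: (@lee_wpmul2l _ (a i g)%:E); first by rewrite lee_fin.
  have muI : (lebesgue_measure (I i g) <= (2 * h i)%R%:E)%E.
    rewrite lebesgue_measure_itv/= lte_fin; case: ifPn => _.
      by rewrite -EFinB lee_fin; lra.
    by rewrite lee_fin mulr_ge0.
  exact: muI.
have : (@lebesgue_measure R).-integrable setT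
    (fun w => (\sum_(0 <= i <oo) f i w)%E).
  apply/integrableP; split.
    exact: (@ge0_emeasurable_sum _ _ _ setT f xpredT).
  under eq_integral do rewrite gee0_abs ?nneseries_ge0//.
  by [].
move=> /(integrable_ae measurableT).
apply: filterS => w /(_ Logic.I) fw.
under eq_eseriesr => i _.
  under eq_bigr => g _.
    have -> : (`|w - c i g| <= h i)%R%:R = \1_(I i g) w :> R.
      rewrite indicE; congr (_%:R); congr nat_of_bool.
      rewrite /I mem_setE in_itv/= ler_distl.
      by [].
    rewrite EFinM.
    over.
  over.
by move: fw; rewrite fin_numE => /andP[_ ?]; rewrite ltey.
Qed.

Lemma ae_lebesgueS (R : realType) (P Q : R -> Prop) : (forall t, P t -> Q t) ->
  {ae (@lebesgue_measure R), forall t, P t} ->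
  {ae (@lebesgue_measure R), forall t, Q t}.
Proof.
move=> PQ [Z [mZ Z0 PZ]]; exists Z; split=> // t /= nQ.
by apply: PZ => /= /PQ.
Qed.

(** Induction on [r]: fixing the first coordinate spends one factor [h p i], and its hit condition
    is absorbed into the new weight [a']. All [p] are treated together, because a single [w] has to
    serve every one of them; this is possible since they are countably many. *)
Lemma exists_coords_ae_hits_finite (R : realType) (r : nat) (N : nat -> nat -> nat)
    (a : nat -> nat -> nat -> R) (c : nat -> nat -> nat -> nat -> R)
    (h : nat -> nat -> R) :
  (forall p i g, 0 <= a p i g) -> (forall p i, 0 <= h p i) ->
  (forall p,
    \sum_(0 <= i <oo) \sum_(g < N p i) (a p i g * h p i ^+ r.+1)%:E < +oo)%E ->
  exists2 w : nat -> R, forall j, 0 <= w j <= 1 &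
  {ae (@lebesgue_measure R), forall t : R, forall p,
    (\sum_(0 <= i <oo) \sum_(g < N p i)
       (a p i g * [&& [forall j : 'I_r, `|w j - c p i g j| <= h p i] &
                      `|t - c p i g r| <= h p i]%R%:R)%:E < +oo)%E}.
Proof.
elim: r a c => [|r IH] a c a0 h0 fin.
  exists (fun=> 0) => [j|]; first by rewrite lexx ler01.
  apply: ae_foralln => p.
  have := @ae_weighted_hits_finite R (N p) (a p) (fun i g => c p i g 0%N) (h p) (a0 p) (h0 p).
  move=> /(_ (fin p)); apply: ae_lebesgueS => t.
  apply: le_lt_trans; apply: lee_nneseries => i _.
    by move=> _; apply: sume_ge0 => g _; rewrite lee_fin mulr_ge0.
  apply: lee_sum => g _; rewrite lee_fin ler_wpM2l// ler_nat.
  by case: forallP => //= _; case: (_ <= _).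
have [w0 w01 fin0] : exists2 w0 : R, 0 <= w0 <= 1 & forall p,
  (\sum_(0 <= i <oo) \sum_(g < N p i) (a p i g * h p i ^+ r.+1 *
    (`|w0 - c p i g 0%N| <= h p i)%R%:R)%:E < +oo)%E.
  have /ae_foralln : forall p, {ae (@lebesgue_measure R), forall w0,
    (\sum_(0 <= i <oo) \sum_(g < N p i) (a p i g * h p i ^+ r.+1 *
     (`|w0 - c p i g 0%N| <= h p i)%R%:R)%:E < +oo)%E}.
    move=> p; apply: (@ae_weighted_hits_finite R (N p) (fun i g => a p i g * h p i ^+ r.+1)
      (fun i g => c p i g 0%N) (h p)) => //.
    - by move=> i g; rewrite mulr_ge0// exprn_ge0.
    - under eq_eseriesr => i _ do under eq_bigr => g _ do
        rewrite -mulrA -exprSr.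
      exact: fin.
  move=> [Z [mZ Z0 HZ]].
  (* The null exceptional set [Z] cannot contain the unit interval, which has measure 1. *)
  apply: contrapT => /forall2NP H.
  have mI : measurable (`[0%R, 1%R] : set R) by exact: measurable_itv.
  have : (lebesgue_measure (`[0%R, 1%R] : set R) = 0)%E.
    apply: (@subset_measure0 _ _ _ (@lebesgue_measure R) _ Z) => //.
    move=> w /=; rewrite in_itv/= => w01; apply: HZ => /= Hw.
    by have [] := H w.
  by rewrite lebesgue_measure_itv/= lte_fin ltr01 sube0 => /eqP; rewrite eqe oner_eq0.
pose a' p i g := a p i g * (`|w0 - c p i g 0%N| <= h p i)%R%:R.
have [w w1 Hw] : exists2 w : nat -> R, forall j, 0 <= w j <= 1 &
  {ae (@lebesgue_measure R), forall t : R, forall p,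
    (\sum_(0 <= i <oo) \sum_(g < N p i)
       (a' p i g * [&& [forall j : 'I_r, `|w j - c p i g j.+1| <= h p i] &
                      `|t - c p i g r.+1| <= h p i]%R%:R)%:E < +oo)%E}.
  apply: (IH a' (fun p i g j => c p i g j.+1)) => //.
    by move=> p i g; rewrite mulr_ge0.
  move=> p.
  under eq_eseriesr => i _ do under eq_bigr => g _ do rewrite /a' mulrAC.
  exact: fin0.
exists (fun j => if j is j'.+1 then w j' else w0) => [[|j]//|].
move: Hw; apply: ae_lebesgueS => t H p.
under eq_eseriesr => i _.
  under eq_bigr => g _.
    rewrite (_ : _ * _ = a' p i g *
      [&& [forall j : 'I_r, `|w j - c p i g j.+1| <= h p i] &
                      `|t - c p i g r.+1| <= h p i]%R%:R); last first.
      rewrite /a' -mulrA -natrM mulnb; congr (_ * (nat_of_bool _)%:R).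
      rewrite andbA; congr andb.
      apply/forallP/andP => [H1|[H1 /forallP H2] [[|j] jr]//=].
        split; first exact: (H1 ord0).
        by apply/forallP => j; have := H1 (lift ord0 j).
      exact: (H2 (Ordinal (jr : (j < r)%N))).
    over.
  over.
exact: H.
Qed.

(** * Differentials of linear functions and flows of constant fields *)

Lemma linear_row_differentiable (R : realType) (l : nat)
    (H : {linear 'rV[R]_l -> R^o}) (x : 'rV[R]_l) :
  differentiable H x /\ 'd H x = H :> (_ -> _).
Proof.
have cH : continuous H.
  have -> : (H : _ -> _) = fun y : 'rV[R]_l => \sum_i (y ord0 i * H (delta_mx ord0 i)).
    apply/funext => y; rewrite {1}(row_sum_delta y) linear_sum.
    by apply: eq_bigr => i _; rewrite linearZ.
  apply: continuous_big => [|i _ y]; first exact: add_continuous.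
  have : continuous (fun z : 'rV[R]_l => (z ord0 i * (H (delta_mx ord0 i) : R) : R)).
    move=> z; apply: (@cvgM R _ _ _ (fun z : 'rV[R]_l => z ord0 i) (fun=> _)).
    - exact: (nbhs_filter z).
    - exact: (@coord_continuous R 1 l ord0 i z).
    - by apply: cvg_cst; exact: (nbhs_filter z).
  exact.
split; [exact: linear_differentiable|exact: diff_lin].
Qed.

Lemma flow_line (R : realType) (l : nat) (v : 'rV[R]_l) :
  is_flow (fun=> v) (fun t x => x + t *: v).
Proof.
split=> [x|x t]; first by rewrite scale0r addr0.
have -> : (fun s : R^o => x + s *: v) = (cst x : R^o -> 'rV[R]_l) + ( *:%R ^~ v).
  by apply/funext.
have dZ : is_diff (t : R^o) ( *:%R ^~ v : R^o -> 'rV[R]_l) ( *:%R ^~ v).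
  exact: is_diff_scalel.
have df := is_diffD (is_diff_cst x (t : R^o)) dZ.
apply: DeriveDef; first by apply: diff_derivable.
by rewrite deriveE// diff_val/= add0r scale1r.
Qed.

(** * Series of nonnegative extended reals *)

(** This serves twice: the sum formula merges a sequence of covers into one cover, and surjectivity
    enumerates the pairs of a Lipschitz piece and a size bound. *)
Lemma nat_pair_reindex (R : realType) :
  exists f : nat -> nat * nat, (forall p, exists k, f k = p) /\
   forall a : nat * nat -> \bar R, (forall p, (0 <= a p)%E) ->
    (\sum_(0 <= k <oo) a (f k) = \sum_(0 <= i <oo) \sum_(0 <= j <oo) a (i, j))%E.
Proof.
have := card_nat2; rewrite card_eq_sym => /card_set_bijP[f fbij].
exists f; split.
  move=> p; have [_ _ /(_ p I)[k _ fk]] := fbij.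
  by exists k.
move=> a a0.
rewrite nneseries_esum ?set_true; last by move=> *; exact: a0.
under [RHS]eq_eseriesr => i _.
  rewrite nneseries_esum ?set_true; last by move=> *; exact: a0.
  over.
rewrite nneseries_esum ?set_true; last by move=> i _; apply: esum_ge0 => *; exact: a0.
rewrite (@esum_esum _ _ _ setT (fun=> setT) (fun i j => a (i, j))); last by move=> *; exact: a0.
rewrite -(reindex_esum setT setT f a)//.
rewrite (_ : setT `*`` (fun=> setT) = setT); last by apply/seteqP.
by apply: eq_esum => -[].
Qed.

Lemma le_nneseries_term (R : realType) (u : nat -> \bar R) (k : nat) :
  (forall i, (0 <= u i)%E) -> (u k <= \sum_(0 <= i <oo) u i)%E.
Proof.
move=> u0; apply: le_trans (nneseries_lim_ge k.+1 _); last by [].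
by rewrite big_nat_recr//= leeDr// sume_ge0.
Qed.

Lemma nneseries_ge1 (R : realType) (u : nat -> \bar R) :
  (forall i, (1 <= u i)%E) -> (\sum_(0 <= i <oo) u i = +oo)%E.
Proof.
move=> u1; apply/eqyP => A A0.
have u0 i : (0 <= u i)%E by exact: le_trans (u1 i).
apply: le_trans (nneseries_lim_ge (Num.truncn A).+1 _); last by [].
apply: (@le_trans _ _ (\sum_(0 <= i < (Num.truncn A).+1) 1%E)).
  rewrite sumEFin lee_fin sumr_const_nat subn0.
  by rewrite ltW// truncnS_gt.
exact: lee_sum.
Qed.

(** * Covers of negligible sets *)

Lemma diam_ge0 (R : realType) (T : Type) (d : T -> T -> R) (S : set T) :
  (0 <= diam d S)%E.
Proof. by apply: ereal_sup_ubound; left. Qed.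

Lemma diam_set0 (R : realType) (T : Type) (d : T -> T -> R) :
  diam d set0 = 0%E.
Proof.
apply/eqP; rewrite eq_le diam_ge0 andbT; by apply: ge_ereal_sup => y [->|[x []]].
Qed.

Lemma le_dist_diam (R : realType) (T : Type) (d : T -> T -> R) (S : set T) x y :
  S x -> S y -> ((d x y)%:E <= diam d S)%E.
Proof. by move=> Sx Sy; apply: ereal_sup_ubound; right; exists x => //; exists y. Qed.

(** One [e] in the bound [2 * e] pays for the diameters, the other for enlarging them to positive
    radii. *)
Lemma s_negligible_cover_seq (R : realType) (T : Type) (d : T -> T -> R)
    (s : nat) (B : set T) (e : R) :
  (0 < s)%N -> s_negligible d s%:R B -> 0 < e <= 1 ->
  exists S : nat -> set T * R,
   [/\ forall i, 0 < (S i).2 <= 1,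
       forall i x y, (S i).1 x -> (S i).1 y -> d x y <= (S i).2,
       (\sum_(0 <= i <oo) ((S i).2 ^+ s)%:E <= (2 * e)%R%:E)%E &
       B `<=` \bigcup_i (S i).1].
Proof.
move=> s0 negB /andP[e0 e1]; have [C [/countable_injP[f finj] _ BC sumC]] := negB e e0.
pose D := f @` C.
have /choice[g gP] : forall k, exists A : set T, (D k -> C A /\ f A = k) /\ (~ D k -> A = set0).
  move=> k; have [[A CA fA]|nD] := pselect (D k).
    by exists A; split => // -[]; exists A.
  by exists set0.
have gbij : set_bij D C g.
  split.
  - by move=> k /(gP k).1[].
  - move=> k1 k2 /set_mem D1 /set_mem D2 g12.
    by have [_ <-] := (gP k1).1 D1; have [_ <-] := (gP k2).1 D2; rewrite g12.
  - move=> A CA; exists (f A); first by exists A.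
    have DA : D (f A) by exists A.
    have [Cg fg] := (gP (f A)).1 DA.
    by apply: finj => //; rewrite inE.
have pw0 A : (0 <= poweR (diam d A) s%:R)%E by exact: poweR_ge0.
have sumg : (\sum_(0 <= k <oo) poweR (diam d (g k)) s%:R < e%:E)%E.
  apply: le_lt_trans sumC.
  rewrite (reindex_esum D C g)//.
  rewrite nneseries_esum//.
  rewrite [leRHS]esum_mkcond set_true.
  apply: le_esum => k _; case: ifPn => // /negP kD.
  rewrite (gP k).2; last by move=> Dk; apply: kD; rewrite inE.
  by rewrite diam_set0 poweR0r// pnatr_eq0 -lt0n.
(* A diameter above 1 would contribute at least [1 >= e] to the sum. *)
have diam1 k : (diam d (g k) <= 1)%E.
  rewrite leNgt; apply/negP => d1.
  have := le_lt_trans (@le_nneseries_term _ _ k (fun k => pw0 (g k))) sumg.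
  have e11 : (e%:E <= 1)%E by rewrite lee_fin.
  move=> /lt_le_trans/(_ e11); apply/negP; rewrite -leNgt.
  move: d1; case: (diam d (g k)) => [r||]//.
    rewrite lte_fin poweR_EFin lee_fin => r1.
    by rewrite powR_mulrn ?exprn_ege1 ?ltW// (lt_trans ltr01).
  by rewrite poweRyr ?leey// pnatr_eq0 -lt0n.
have diamE k : diam d (g k) = (fine (diam d (g k)))%:E.
  by rewrite fineK// ge0_fin_numE ?diam_ge0// (le_lt_trans (diam1 k))// ltry.
(* The radii must be positive even when the [k]-th set is a point. *)
pose tau k : R := e / (2 ^ k.+1)%:R.
have tau0 k : 0 < tau k by rewrite divr_gt0// ltr0n expn_gt0.
have tau1 k : tau k <= 1.
  by rewrite ler_pdivrMr ?ltr0n ?expn_gt0// mul1r (le_trans e1)// ler1n expn_gt0.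
have fd0 k : 0 <= fine (diam d (g k)) by rewrite fine_ge0// diam_ge0.
exists (fun k => (g k, Num.max (fine (diam d (g k))) (tau k))); split => /=.
- move=> k; rewrite lt_max tau0 orbT/= ge_max tau1 andbT.
  by rewrite -lee_fin -diamE.
- move=> k x y gx gy; rewrite le_max; apply/orP; left.
  by rewrite -lee_fin -diamE le_dist_diam.
- apply: (@le_trans _ _ (\sum_(0 <= k <oo)
      (poweR (diam d (g k)) s%:R + (tau k)%:E))%E).
    apply: lee_nneseries => k _; first by rewrite lee_fin exprn_ge0// le_max fd0.
    rewrite diamE poweR_EFin powR_mulrn// -EFinD lee_fin.
    have t0 := ltW (tau0 k).
    (* When [tau k] is the maximum, [tau k ^+ s <= tau k] since [tau k <= 1] and [s > 0]; the
       [tau k] sum to [e]. *)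
    have [ft|tf] := leP (fine (diam d (g k))) (tau k).
      rewrite (@le_trans _ _ (tau k))// ?lerDr ?exprn_ge0//.
      by rewrite ler_iXnr.
    by rewrite lerDl.
  apply: le_trans (epsilon_trick _ _ _) _ => //; first exact: ltW.
  by rewrite mulr2n mulrDl mul1r EFinD leeD2r// ltW.
- move=> b /BC[A CA Ab]; exists (f A) => //=.
  have DA : D (f A) by exists A.
  have [Cg fg] := (gP (f A)).1 DA.
  by rewrite (finj _ _ _ _ fg)// inE.
Qed.

(** Covers with bounds [e n = 2^-(n+1)] are merged into one sequence. The sums of [h ^ s] add up to
    at most 2, while each point of [B] is met at least once by each of the infinitely many
    covers. *)
Lemma s_negligible_limsup_cover (R : realType) (T : Type) (d : T -> T -> R)
    (s : nat) (B : set T) :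
  (0 < s)%N -> s_negligible d s%:R B ->
  exists (S : nat -> set T) (h : nat -> R),
   [/\ forall i, 0 < h i <= 1,
       forall i x y, S i x -> S i y -> d x y <= h i,
       (\sum_(0 <= i <oo) (h i ^+ s)%:E < +oo)%E &
       forall b, B b -> (\sum_(0 <= i <oo) (\1_(S i) b)%:E = +oo :> \bar R)%E].
Proof.
move=> s0 negB.
pose e n : R := 1 / (2 ^ n.+1)%:R.
have e01 n : 0 < e n <= 1.
  rewrite /e div1r invr_gt0 ltr0n expn_gt0/= invf_le1 ?ltr0n ?expn_gt0//.
  by rewrite ler1n expn_gt0.
have /choice[V HV] n := @s_negligible_cover_seq _ _ _ _ _ _ s0 negB (e01 n).
have [f [_ fsum]] := nat_pair_reindex R.
exists (fun k => (V (f k).1 (f k).2).1), (fun k => (V (f k).1 (f k).2).2); split.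
- by move=> k; have [H _ _ _] := HV (f k).1; exact: H.
- by move=> k; have [_ H _ _] := HV (f k).1; exact: H.
- rewrite (fsum (fun p => ((V p.1 p.2).2 ^+ s)%:E)); last first.
    move=> p; rewrite lee_fin exprn_ge0//.
    by case: (HV p.1) => /(_ p.2)/andP[/ltW].
  apply: (@le_lt_trans _ _ (\sum_(0 <= n <oo) (2 / (2 ^ n.+1)%:R)%:E)%E).
    apply: lee_nneseries => n _.
      move=> _; apply: nneseries_ge0 => k _ _; rewrite lee_fin exprn_ge0//.
      by case: (HV n) => /(_ k)/andP[/ltW].
    by case: (HV n) => _ _ + _; rewrite /e mulrA mulr1.
  by apply: le_lt_trans (epsilon_trick0 xpredT _) _; rewrite ?ltry.
- move=> b Bb.
  rewrite (fsum (fun p => (\1_((V p.1 p.2).1) b)%:E)); last by move=> p; rewrite lee_fin.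
  apply: nneseries_ge1 => n.
  case: (HV n) => _ _ _ /(_ b Bb)[k _ Vb].
  have := @le_nneseries_term R (fun j => (\1_((V n j).1) b)%:E) k.
  move=> /(_ (fun _ => _))/=; rewrite {1}indicE mem_set// => H; apply: H => j.
  by rewrite lee_fin.
Qed.

(** * Distance estimates, grids and boxes *)

Lemma coord_le_eucl_dist (R : realType) (l : nat) (u v : 'rV[R]_l) i :
  `|u ord0 i - v ord0 i| <= eucl_dist u v.
Proof.
rewrite -sqrtr_sqr ler_sqrt; last by apply: sumr_ge0 => j _; exact: sqr_ge0.
by rewrite (bigD1 i)//= lerDl sumr_ge0// => j _; exact: sqr_ge0.
Qed.

Lemma eucl_dist_le_sup (R : realType) (l : nat) (u v : 'rV[R]_l) (h : R) :
  (forall i, `|u ord0 i - v ord0 i| <= h) -> 0 <= h -> eucl_dist u v <= l%:R * h.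
Proof.
move=> uvh h0.
rewrite /eucl_dist -[leRHS]ger0_norm ?mulr_ge0// -sqrtr_sqr ler_sqrt ?sqr_ge0//.
apply: (@le_trans _ _ (\sum_(i < l) h ^+ 2)).
  apply: ler_sum => i _.
  by rewrite -(real_normK (num_real _)) lerXn2r ?nnegrE.
rewrite sumr_const card_ord exprMn -[leLHS]mulr_natl ler_wpM2r ?sqr_ge0// -natrX ler_nat.
by case: (l) => // k; rewrite -mulnn leq_pmulr.
Qed.

(** With [K] cells per axis, [K * h <= 2 * M + h <= 2 * M + 1]; the last inequality is where
    [h <= 1] enters. *)
Lemma cube_grid_cover (R : realType) (m : nat) (M h : R) : 0 <= M -> 0 < h <= 1 ->
  exists (N : nat) (Z : nat -> set 'rV[R]_m),
  [/\ forall x : 'rV[R]_m, (forall q, `|x ord0 q| <= M) ->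
        exists2 g, (g < N)%N & Z g x,
      forall g x y, Z g x -> Z g y -> forall q, `|x ord0 q - y ord0 q| <= h &
      N%:R * h ^+ m <= (2 * M + 1) ^+ m].
Proof.
move=> M0 /andP[h0 h1].
(* The successor makes room for the last, possibly partial, cell and the face where a coordinate
   equals [M]. *)
pose K := (Num.truncn (2 * M / h)).+1.
pose cell (x : 'rV[R]_m) : {ffun 'I_m -> 'I_K} :=
  [ffun q => inord (Num.truncn ((x ord0 q + M) / h))].
exists #|{ffun 'I_m -> 'I_K}|.
exists (fun g => [set x : 'rV[R]_m | (forall q, `|x ord0 q| <= M) /\ 
  nat_of_ord (enum_rank (cell x)) = g]).
have K0 (x : 'rV[R]_m) q : `|x ord0 q| <= M -> (Num.truncn ((x ord0 q + M) / h) < K)%N.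
  rewrite ler_norml => /andP[x1 x2]; rewrite ltnS.
  apply: le_truncn; rewrite ler_pM2r ?invr_gt0//; lra.
split.
- by move=> x xM; exists (enum_rank (cell x)); first exact: ltn_ord.
- move=> g x y [xM xg] [yM]; rewrite -xg => /ord_inj/enum_rank_inj.
  move=> /ffunP xy q; move: (xy q); rewrite !ffunE => /(congr1 val).
  rewrite /= !inordK ?K0// => E.
  have tx : 0 <= (x ord0 q + M) / h.
    by have := xM q; rewrite ler_norml => /andP[? ?]; rewrite divr_ge0 ?(ltW h0)//; lra.
  have ty : 0 <= (y ord0 q + M) / h.
    by have := yM q; rewrite ler_norml => /andP[? ?]; rewrite divr_ge0 ?(ltW h0)//; lra.
  have /andP[x1 x2] := truncn_itv tx; have /andP[y1 y2] := truncn_itv ty.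
  move: y1 y2; rewrite E => y1 y2.
  rewrite -natr1 in x2 y2.
  set X := (x ord0 q + M) / h in x1 x2; set Y := (y ord0 q + M) / h in y1 y2.
  have -> : x ord0 q - y ord0 q = (X - Y) * h.
    by rewrite /X /Y -mulrBl divfK ?gt_eqF// opprD addrACA subrr addr0.
  rewrite normrM (gtr0_norm h0) ger_pMl// ler_norml; lra.
- rewrite card_ffun !card_ord natrX -exprMn.
  apply: lerXn2r; rewrite ?nnegrE ?mulr_ge0 ?(ltW h0)//; first by lra.
  rewrite /K -natr1 mulrDl mul1r lerD// -ler_pdivlMr//.
  by rewrite truncn_le// divr_ge0 ?(ltW h0)// mulr_ge0.
Qed.

(** The product [t * (w - w')] equals [(t * w - t' * w') - (t - t') * w'], of size at most
    [2 * rho], and dividing by [t] costs a factor [K]. *)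
Lemma slope_dist_le (R : realType) (t t' w w' K rho : R) :
  `|t * w - t' * w'| <= rho -> `|t - t'| <= rho -> 1 <= K * `|t| ->
  0 <= w' <= 1 -> 0 <= K -> `|w - w'| <= 2 * K * rho.
Proof.
move=> tw tt Kt /andP[w0 w1] K0.
have rho0 : 0 <= rho by exact: le_trans tt.
apply: (@le_trans _ _ (K * `|t| * `|w - w'|)); first by rewrite ler_peMl.
have -> : 2 * K * rho = K * (rho + rho) by ring.
rewrite -mulrA ler_wpM2l// -normrM.
have -> : t * (w - w') = (t * w - t' * w') - (t - t') * w' by ring.
apply: le_trans (ler_normB _ _) _; apply: lerD => //.
by rewrite normrM (ger0_norm w0) (le_trans _ tt)// ler_piMr.
Qed.

(** * A direction that works for almost every time *)

(** Time 0 has to be discarded, as no [K] satisfies [1 <= K * |t|] there. *)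
Lemma ae_lebesgueS_neq0 (R : realType) (P Q : R -> Prop) :
  (forall t, t != 0 -> P t -> Q t) ->
  {ae (@lebesgue_measure R), forall t, P t} ->
  {ae (@lebesgue_measure R), forall t, Q t}.
Proof.
move=> PQ aeP.
have n0 : (@lebesgue_measure R).-negligible [set 0].
  exists [set 0]; split => //; exact: lebesgue_measure_set1.
apply: negligibleS (negligibleU aeP n0) => t /= nQ.
have [->|t0] := eqVneq t 0; first by right.
by left => Pt; apply: nQ; exact: PQ.
Qed.

(* [w] stands for the direction whose last coordinate is 1, and the centre of the
   [t]-range is stored in the last coordinate of [c]. *)
Lemma exists_box_center (R : realType) (l m : nat) (f : 'rV[R]_m -> 'rV[R]_l)
    (D Z : set 'rV[R]_m) (S : set 'rV[R]_l) (L h K : R) :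
  (0 < l)%N -> 0 <= L -> 0 <= h -> 1 <= K ->
  (forall x y, D x -> D y -> eucl_dist (f x) (f y) <= L * eucl_dist x y) ->
  (forall x y, Z x -> Z y -> forall q, `|x ord0 q - y ord0 q| <= h) ->
  (forall x y, S x -> S y -> eucl_dist x y <= h) ->
  exists c : nat -> R, forall (t : R) (w : nat -> R) x b,
    1 <= K * `|t| -> (forall j, 0 <= w j <= 1) -> D x -> Z x -> S b ->
    (forall j : 'I_l, t * (if (j < l.-1)%N then w j else 1) = b ord0 j - f x ord0 j) ->
    (forall j, (j < l.-1)%N -> `|w j - c j| <= 2 * K * ((1 + L * m%:R) * h)) /\
    `|t - c l.-1| <= 2 * K * ((1 + L * m%:R) * h).
Proof.
move=> l0 L0 h0 K1 Lf Zh Sh.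
(* [Q] describes the parameters that hit. Any one of them can serve as the centre; if there is none,
   every centre works vacuously. *)
pose Q (tw : R * (nat -> R)) := [/\ 1 <= K * `|tw.1|, forall j, 0 <= tw.2 j <= 1 &
  exists x b, [/\ D x, Z x, S b & forall j : 'I_l,
    tw.1 * (if (j < l.-1)%N then tw.2 j else 1) = b ord0 j - f x ord0 j]].
have [[[t0 w0] [/= _ w01 [x0 [b0 [Dx0 Zx0 Sb0 E0]]]]]|nQ] := pselect (exists tw, Q tw); last first.
  exists (fun=> 0) => t w x b Kt w1 Dx Zx Sb E; exfalso; apply: nQ.
  by exists (t, w); split => //; exists x, b.
exists (fun j => if (j < l.-1)%N then w0 j else t0) => t w x b Kt w1 Dx Zx Sb E.
set rho := (1 + L * m%:R) * h.
have K0 : 0 <= K by exact: le_trans K1.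
(* Both displacements lie in [S - f(Z)]: [S] contributes [h], and the image of the cell contributes
   [L * m * h]. *)
have key (j : 'I_l) : `|t * (if (j < l.-1)%N then w j else 1) -
    t0 * (if (j < l.-1)%N then w0 j else 1)| <= rho.
  rewrite E E0.
  have -> : b ord0 j - f x ord0 j - (b0 ord0 j - f x0 ord0 j) =
    (b ord0 j - b0 ord0 j) - (f x ord0 j - f x0 ord0 j) by ring.
  apply: le_trans (ler_normB _ _) _; rewrite /rho mulrDl mul1r; apply: lerD.
    by apply: le_trans (coord_le_eucl_dist _ _ _ _ _) _; exact: Sh.
  apply: le_trans (coord_le_eucl_dist _ _ _ _ _) _.
  apply: le_trans (Lf _ _ Dx Dx0) _; rewrite -mulrA ler_wpM2l//.
  by apply: eucl_dist_le_sup => //; exact: Zh.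
have lr : (l.-1 < l)%N by rewrite prednK.
(* The last coordinate of the direction is 1, so that of the displacement is the time itself. *)
have tt0 : `|t - t0| <= rho.
  by have := key (Ordinal lr); rewrite /= ltnn !mulr1.
split=> [j jr|]; last first.
  rewrite ltnn (le_trans tt0)// ler_peMl//; last by lra.
  exact: le_trans tt0.
rewrite jr; have := key (Ordinal (ltn_trans jr lr)); rewrite /= jr => key_j.
exact: (slope_dist_le _ t t0).
Qed.

Lemma exists_direction (R : realType) (l m : nat) (A B : set 'rV[R]_l) :
  (m < l)%N -> countably_rectifiable (@eucl_dist R l) m A ->
  s_negligible (@eucl_dist R l) (l - m)%N%:R B ->
  exists v : 'rV[R]_l,
    {ae (@lebesgue_measure R), forall t : R, (fun x => x + t *: v) @` A `&` B = set0}.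
Proof.
move=> ml [F [cF LF AF]] negB.
have /pfcard_geP[F0|[G]] : (F #<= [set: nat])%card by [].
  exists 0; apply: aeW => t; apply/seteqP; split => // y [[x]].
  by rewrite AF F0 => -[].
have l0 : (0 < l)%N by exact: leq_ltn_trans ml.
have GF q : F (G q) by exact: funS.
have /choice[L HL] : forall q, exists L : R, 0 <= L /\ forall x y,
    (G q).1 x -> (G q).1 y ->
    eucl_dist ((G q).2 x) ((G q).2 y) <= L * eucl_dist x y.
  move=> q; have [L HL] := LF _ (GF q).
  (* [lipschitz_map] allows a negative constant. *)
  exists (Num.max L 0); split=> [|x y Dx Dy]; first by rewrite le_max lexx orbT.
  apply: le_trans (HL _ _ Dx Dy) _; rewrite ler_wpM2r ?sqrtr_ge0//.
  by rewrite le_max lexx.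
have [f [fsurj _]] := nat_pair_reindex R.
have [S [h [h01 Sh sumh SB]]] : exists (S : nat -> set 'rV[R]_l) (h : nat -> R),
   [/\ forall i, 0 < h i <= 1,
       forall i x y, S i x -> S i y -> eucl_dist x y <= h i,
       (\sum_(0 <= i <oo) (h i ^+ (l - m))%:E < +oo)%E &
       forall b, B b -> (\sum_(0 <= i <oo) (\1_(S i) b)%:E = +oo :> \bar R)%E].
  by apply: (@s_negligible_limsup_cover R _ _ (l - m) B) => //; rewrite subn_gt0.
have h0 i : 0 <= h i by have /andP[/ltW] := h01 i.
(* Each [p] encodes a piece [q p] of [A] and a bound [K p], used both for the cube of side [2 * K p]
   in the domain and for the times with [|t| >= 1 / K p]. *)
pose q p := (f p).1; pose K p : R := (f p).2.+1%:R.
have K1 p : 1 <= K p by rewrite ler1n.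
have K0 p : 0 <= K p by rewrite ler0n.
have /choice[NZ HNZ] : forall pi : nat * nat, exists NZ : nat * (nat -> set 'rV[R]_m),
  [/\ forall x : 'rV[R]_m, (forall j, `|x ord0 j| <= K pi.1) ->
        exists2 g, (g < NZ.1)%N & NZ.2 g x,
      forall g x y, NZ.2 g x -> NZ.2 g y ->
        forall j, `|x ord0 j - y ord0 j| <= h pi.2 &
      NZ.1%:R * h pi.2 ^+ m <= (2 * K pi.1 + 1) ^+ m].
  move=> [p i]; have [N [Z HZ]] := cube_grid_cover R m (K p) (h i) (K0 p) (h01 i).
  by exists (N, Z).
pose N p i := (NZ (p, i)).1; pose Z p i := (NZ (p, i)).2.
pose C p : R := 2 * K p * (1 + L (q p) * m%:R).
pose eta p i := 2 * K p * ((1 + L (q p) * m%:R) * h i).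
have L0 p : 0 <= L p by have [] := HL p.
have C0 p : 0 <= C p by rewrite /C !mulr_ge0// addr_ge0// mulr_ge0.
have etaE p i : eta p i = C p * h i by rewrite /eta /C !mulrA.
have /choice[c Hc] : forall pig : nat * nat * nat, exists c : nat -> R,
  forall (t : R) (w : nat -> R) x b,
    1 <= K pig.1.1 * `|t| -> (forall j, 0 <= w j <= 1) ->
    (G (q pig.1.1)).1 x -> Z pig.1.1 pig.1.2 pig.2 x -> S pig.1.2 b ->
    (forall j : 'I_l, t * (if (j < l.-1)%N then w j else 1) =
       b ord0 j - (G (q pig.1.1)).2 x ord0 j) ->
    (forall j, (j < l.-1)%N -> `|w j - c j| <= eta pig.1.1 pig.1.2) /\
    `|t - c l.-1| <= eta pig.1.1 pig.1.2.
  move=> [[p i] g] /=; apply: exists_box_center => //.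
  - by have [] := HL (q p).
  - by have [_ + _] := HNZ (p, i); apply.
  - exact: Sh.
have [||p|w w01 Hw] := @exists_coords_ae_hits_finite R l.-1 N (fun _ _ _ => 1)
    (fun p i g => c (p, i, g)) eta.
- by move=> _ _ _; exact: ler01.
- by move=> p i; rewrite etaE mulr_ge0.
- rewrite prednK//.
  (* The [N p i] boxes contribute [N p i * (C p * h i) ^ l]. The grid bound on [N p i * h i ^ m]
     leaves the summable factor [h i ^ (l - m)]. *)
  apply: (@le_lt_trans _ _ (\sum_(0 <= i <oo)
     (((2 * K p + 1) ^+ m * C p ^+ l)%:E * (h i ^+ (l - m))%:E))%E); last first.
    rewrite nneseriesZl; last by move=> i _; rewrite lee_fin exprn_ge0.
    by rewrite lte_mul_pinfty// lee_fin mulr_ge0// exprn_ge0// addr_ge0// mulr_ge0.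
  apply: lee_nneseries => i _.
    by move=> _; apply: sume_ge0 => g _; rewrite lee_fin mul1r exprn_ge0// etaE mulr_ge0.
  rewrite sumEFin -EFinM lee_fin sumr_const card_ord mul1r etaE exprMn.
  rewrite -{1}(subnKC (ltnW ml)) -[leLHS]mulr_natl.
  have [_ _ HN] := HNZ (p, i).
  have -> : (N p i)%:R * (C p ^+ (m + (l - m)) * h i ^+ l) =
      ((N p i)%:R * h i ^+ m) * (C p ^+ l * h i ^+ (l - m)).
    by rewrite subnKC ?(ltnW ml)// -{2}(subnKC (ltnW ml)) exprD; ring.
  by rewrite -[leRHS]mulrA ler_wpM2r// mulr_ge0 ?exprn_ge0.
exists (\row_j if (j < l.-1)%N then w j else 1).
apply: (ae_lebesgueS_neq0 R _ _ _ Hw) => t t0 Ht.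
apply/seteqP; split => // b [[x Ax xb] Bb]; exfalso.
move: Ax; rewrite AF => -[g Fg [y Dy yx]].
have [q0 _ Gq0] : exists2 q0, [set: nat] q0 & G q0 = g by exact: (@surj _ _ _ _ G).
(* This [k] bounds all coordinates of [y] and the inverse of [|t|] at once. *)
pose k := Num.truncn (\sum_j `|y ord0 j| + `|t|^-1).
have kE : \sum_j `|y ord0 j| + `|t|^-1 < k.+1%:R by exact: truncnS_gt.
have sum0 : 0 <= \sum_j `|y ord0 j| by apply: sumr_ge0.
have it0 : 0 < `|t|^-1 by rewrite invr_gt0 normr_gt0.
have [p fp] := fsurj (q0, k).
have KE : K p = k.+1%:R by rewrite /K fp.
have := Ht p; rewrite ltNge => /negP; apply.
(* The divergent series of indicators at [b] is dominated termwise by the series of hits: whenever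
   [b] lies in [S i], the cell [g'] containing [y] gives a box that is hit. *)
rewrite -(SB b Bb); apply: lee_nneseries => i _; first by rewrite lee_fin.
rewrite indicE; have [/set_mem Sb|_] := boolP (b \in S i); last first.
  by apply: sume_ge0 => g' _; rewrite lee_fin mul1r.
have [HN _ _] := HNZ (p, i).
have [j|g' g'N Zy] := HN y.
  rewrite KE; apply: le_trans (ltW kE).
  rewrite (bigD1 j)//= -addrA lerDl addr_ge0 ?(ltW it0)//.
  by apply: sumr_ge0.
rewrite (bigD1 (Ordinal g'N))//= mul1r.
have Kt : 1 <= K p * `|t|.
  rewrite -ler_pdivrMr ?normr_gt0// mul1r KE; apply: le_trans (ltW kE).
  by rewrite lerDr.
have qp : q p = q0 by rewrite /q fp.
have Dq : (G (q p)).1 y by rewrite qp Gq0.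
have [j|H1 H2] := Hc (p, i, g') t w y b Kt w01 Dq Zy Sb.
  by rewrite -xb /= qp Gq0 yx !mxE addrAC subrr add0r.
rewrite H2 andbT (_ : [forall j : 'I_l.-1, _] = true); last by apply/forallP => j; exact: H1.
by rewrite leeDl// sume_ge0// => g2 _; rewrite lee_fin mul1r.
Qed.

(** * The top-dimensional case and the Hamiltonian *)

(** For exponent 0 each member of a cover contributes 1, so a total below 1 leaves no member at
    all. *)
Lemma zero_negligible_set0 (R : realType) (T : Type) (d : T -> T -> R) (B : set T) :
  s_negligible d 0 B -> B = set0.
Proof.
move=> /(_ 1 ltr01)[C [_ _ BC sumC]]; apply/seteqP; split => // b /BC[S CS _].
move: sumC; apply/negP; rewrite -leNgt.
apply: esum_ge; exists [set S]; first by split=> [|_ ->//]; exact: finite_set1.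
by rewrite fsbig_set1 poweRe0.
Qed.

Fact omega_st_is_linear (R : realType) (n : nat) (u : 'rV[R]_(n + n)) :
  linear (omega_st u : 'rV[R]_(n + n) -> R^o).
Proof.
move=> k x y; rewrite /omega_st scaler_sumr -big_split/=.
by apply: eq_bigr => i _; rewrite !mxE /GRing.scale/=; ring.
Qed.

HB.instance Definition _ (R : realType) (n : nat) (u : 'rV[R]_(n + n)) :=
  GRing.isLinear.Build R 'rV[R]_(n + n) R^o _ (omega_st u : 'rV[R]_(n + n) -> R^o)
    (omega_st_is_linear R n u).

(** The linear function [omega_st u] is its own differential, so the constant field [u] satisfies
    the defining equation. *)
Lemma omega_st_hamiltonian_flow (R : realType) (n : nat) (u : 'rV[R]_(n + n)) :
  is_hamiltonian_flow (omega_st u : 'rV[R]_(n + n) -> R^o) (fun t x => x + t *: u).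
Proof.
exists (fun=> u); split; last exact: flow_line.
move=> x; have [dH dE] := linear_row_differentiable R _
  (omega_st u : {linear 'rV[R]_(n + n) -> R^o}) x.
by split => // v; rewrite dE.
Qed.

Theorem theorem6 (R : realType) (n m : nat) (hm : (m <= n + n)%N)
    (A B : set 'rV[R]_(n + n))
    (hA : countably_rectifiable (@eucl_dist R (n + n)%N) m A)
    (hB : s_negligible (@eucl_dist R (n + n)%N) (n + n - m)%N%:R B) :
  exists (H : {linear 'rV[R]_(n + n) -> R^o})
         (phi : R -> 'rV[R]_(n + n) -> 'rV[R]_(n + n)),
    is_hamiltonian_flow H phi /\
    {ae (@lebesgue_measure R), forall t : R, phi t @` A `&` B = set0}.
Proof.
have [v Hv] : exists v : 'rV[R]_(n + n),
    {ae (@lebesgue_measure R), forall t : R, (fun x => x + t *: v) @` A `&` B = set0}.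
  move: hm; rewrite leq_eqVlt => /orP[/eqP mn|mn]; last exact: (exists_direction R _ m).
  (* Here [m = 2n], so [B] is empty and any direction works. *)
  exists 0; apply: aeW => t.
  rewrite (zero_negligible_set0 R _ (@eucl_dist R (n + n)%N) B) ?setI0//.
  by move: hB; rewrite mn subnn.
exists (omega_st v : {linear 'rV[R]_(n + n) -> R^o}), (fun t x => x + t *: v).
by split; first exact: omega_st_hamiltonian_flow.
Qed.
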